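(* Let $n\ge2$ and $m\ge1$ be integers, let $\lambda=(\lambda_1,\dots,\lambda_l)$ be a partition with $\lambda_i\ge m+1$ for all $1\le i\le l$, and let $\nu=(\nu_1,\dots,\nu_{l'})$ be a partition with $\nu_1\le m-1$. Set $\kappa_0=(\lambda,m,m,\nu)$, $\kappa_1=(\lambda,m+1,m-1,\nu)$ and $\kappa_2=(\lambda_1-1,\dots,\lambda_l-1,\nu_1,\dots,\nu_{l'})$, and assume $\kappa_0$ has at most $n-1$ positive parts with each positive integer occurring at most twice. Then $$\mathfrak C^{n}(\kappa_0)=\mathfrak C^{n}(\kappa_1)+q^{\beta}\,\mathfrak C^{n-1}(\kappa_2),\qquad \beta=2(n-m-1)-l.$$
   Context: For $k\ge1$: grid with $2k$ rows numbered $1,\dots,2k$ from top to bottom and $k$ columns numbered $1,\dots,k$ from left to right; box $(i,j)$ is in row $i$, column $j$. For a partition $\lambda$ (with $\lambda_i=0$ beyond its last part; parts equal to $0$ are ignored), a Dellac configuration of size $k$ with boundaries $\lambda$ and $\delta_{k-1}=(k-1,\dots,1)$ is a set of $2k$ boxes (''dots'') such that each row contains exactly one dot, each column contains exactly two dots, no dot lies in a box $(i,j)$ with $j\le\lambda_i$, and no dot lies in a box $(i,j)$ with $k+2\le i\le 2k$ and $j\ge 2k+2-i$. An inversion is a pair of dots one of which lies strictly above and strictly to the left of the other. $\mathfrak C^k(\lambda)=\sum_C q^{\mathrm{inv}(C)}$ over all such configurations (zero if none).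
   Formalization: Adds the assumption m ≤ n−1 when λ is empty; without it the identity fails, e.g. n=m=3 with λ, ν empty, where C^3(3,3)=C^3(4,2)=0 but C^2 of the empty partition is nonzero. *)

(* Defs.v *)
From mathcomp Require Import all_boot all_order all_algebra.

Set Implicit Arguments.
Unset Strict Implicit.
Unset Printing Implicit Defensive.

Import GRing.Theory.

(* Ordinals count from 0, whereas rows and columns are numbered from 1. *)
Definition box (k : nat) : finType := ('I_(2 * k) * 'I_k)%type.
Definition row_of (k : nat) (b : box k) : nat := b.1.+1.
Definition col_of (k : nat) (b : box k) : nat := b.2.+1.

(* Trailing zeros are allowed; they are irrelevant to everything below. *)
Definition is_partition (lam : seq nat) : bool := sorted geq lam.

(* The i-th part of lam, for i >= 1; it is 0 beyond the last part. *)
Definition part (lam : seq nat) (i : nat) : nat := nth 0 lam i.-1.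

(* C is the set of dots; the last two conditions are the boundaries lam and
   delta_(k-1) = (k-1, ..., 1). *)
Definition dellac (k : nat) (lam : seq nat) (C : {set box k}) : bool :=
  [&& [forall i : 'I_(2 * k), #|[set b in C | b.1 == i]| == 1],
      [forall j : 'I_k, #|[set b in C | b.2 == j]| == 2],
      [forall b in C, ~~ (col_of b <= part lam (row_of b))] &
      [forall b in C,
         ~~ ((k + 2 <= row_of b <= 2 * k)
             && (2 * k + 2 - row_of b <= col_of b))]].

(* Ordering each inverted pair with the upper left dot first counts it
   exactly once. *)
Definition inv (k : nat) (C : {set box k}) : nat :=
  #|[set p : box k * box k | [&& p.1 \in C, p.2 \in C,
       row_of p.1 < row_of p.2 & col_of p.1 < col_of p.2]]|.

Definition dellac_poly (k : nat) (lam : seq nat) : {poly int} :=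
  (\sum_(C : {set box k} | dellac lam C) 'X^(inv C))%R.

(* Integer powers of q may have a negative exponent, so identities involving
   them are stated in the field of fractions of Z[q]. *)
Definition qfrac : {fraction {poly int}} := tofrac ('X : {poly int})%R.
Definition dellac_frac (k : nat) (lam : seq nat) : {fraction {poly int}} :=
  tofrac (dellac_poly k lam).

(* Main.v *)
(* Reading the dots of a configuration row by row gives a word in the columns,
   and q^inv is the factor that brings this word to its inversion-free order in
   the quantum plane x_i x_j = q x_j x_i (i < j).  So C^k(kappa) is the
   coefficient of the product of all x_j^2 in the product, over the rows, of the
   sums of the allowed variables.

   Let x, y be the variables of columns m, m+1, let P and S be the sums of the
   variables to their left and right, let x + P be the last row allowing x, and
   let G be the product of the rows strictly between row l+2 and that row; all of
   them allow both x and y.  As (y+S)^2 - S(x+y+S) = y^2 + S(qy - x), the difference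
   of C^n(kappa_0) and C^n(kappa_1) comes from (y^2 + S(qy - x)) G (x + P), where G
   depends on x and y only through t = x + y, the variable of a merged column.  Extracting the
   coefficient of y^2 x^2 turns this into a map Phi applied to G, up to the factor
   q^(degree in S).  Phi commutes with left multiplication by rows containing t
   and everything right of it, and with right multiplication by rows containing t
   and everything left of it, and Phi(1) = P + t + S; hence it inserts one
   unrestricted row into G, which yields a configuration counted by kappa_2.
   Finally the l rows of lambda use l of the 2(n-m-1) places in S, which gives
   the exponent beta. *)
From mathcomp Require Import all_boot all_order all_algebra.
From mathcomp Require Import boolp functions.
From mathcomp Require Import zify ring.
Require Import Defs.

Set Implicit Arguments.
Unset Strict Implicit.
Unset Printing Implicit Defensive.

Import GRing.Theory.
Local Open Scope ring_scope.

Definition dec (j : nat) (c : nat -> nat) : nat -> nat :=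
  fun i => (c i - (i == j))%N.
Definition inc (j : nat) (c : nat -> nat) : nat -> nat :=
  fun i => (c i + (i == j))%N.
Arguments dec : simpl never.
Arguments inc : simpl never.

(** * Multidegrees *)

Section Contents.

(** The powers of [q] paid when a factor x_j is sorted into place: [lts] for a factor coming from
    the right, [gts] for one coming from the left. *)
Definition lts (j : nat) (c : nat -> nat) : nat := (\sum_(i < j) c i)%N.
Definition gts (N j : nat) (c : nat -> nat) : nat :=
  (\sum_(i < N | j < i) c i)%N.

Lemma sum_pred1 N (P : pred nat) k :
  (\sum_(i < N | P i) (i == k :> nat))%N = (k < N)%N && P k :> nat.
Proof.
rewrite big_mkcond /=; case: (ltnP k N) => kN /=.
  rewrite (bigD1 (Ordinal kN)) //= eqxx big1 ?addn0 => [|i]; first by case: (P k).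
  by rewrite -val_eqE /= => /negPf->; case: ifP.
by rewrite big1 // => i _; case: eqP => [e|]; [have := ltn_ord i; lia | case: ifP].
Qed.

Lemma sum_dec N (P : pred nat) k (c : nat -> nat) : (0 < c k)%N ->
  (\sum_(i < N | P i) c i
   = \sum_(i < N | P i) dec k c i + ((k < N)%N && P k))%N.
Proof.
move=> ck; rewrite -sum_pred1 -big_split /=; apply: eq_bigr => i _.
by rewrite /dec subnK //; case: eqP => // ->.
Qed.

Lemma sum_inc N (P : pred nat) k (c : nat -> nat) :
  (\sum_(i < N | P i) inc k c i
   = \sum_(i < N | P i) c i + ((k < N)%N && P k))%N.
Proof. by rewrite -sum_pred1 -big_split. Qed.

Lemma gts_dec N j k c : (0 < c k)%N ->
  gts N j c = (gts N j (dec k c) + (j < k < N))%N.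
Proof. by move=> ck; rewrite /gts (sum_dec _ (fun i => j < i)%N ck) andbC. Qed.

Lemma lts_dec j k c : (0 < c k)%N -> lts j c = (lts j (dec k c) + (k < j))%N.
Proof. by move=> ck; rewrite /lts (sum_dec _ predT ck) andbT. Qed.

Lemma gts_inc N j k c : gts N j (inc k c) = (gts N j c + (j < k < N))%N.
Proof. by rewrite /gts (sum_inc _ (fun i => j < i)%N) andbC. Qed.

Lemma lts_inc j k c : lts j (inc k c) = (lts j c + (k < j))%N.
Proof. by rewrite /lts (sum_inc _ predT) andbT. Qed.

Lemma dec_neq i j c : i != j -> dec j c i = c i.
Proof. by move=> /negPf ij; rewrite /dec ij subn0. Qed.

Lemma decC j k c : dec j (dec k c) = dec k (dec j c).
Proof. by apply/funext => i; rewrite /dec subnAC. Qed.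

Lemma incK j : cancel (inc j) (dec j).
Proof. by move=> c; apply/funext => i; rewrite /inc /dec addnK. Qed.

Lemma decK j c : (0 < c j)%N -> inc j (dec j c) = c.
Proof.
move=> cj; apply/funext => i; rewrite /inc /dec subnK //.
by case: eqP => // ->.
Qed.

Lemma dec_inc j k c : j != k -> dec j (inc k c) = inc k (dec j c).
Proof. by move=> jk; apply/funext => i; rewrite /inc /dec; lia. Qed.

End Contents.

(** * Multiplication operators of the quantum plane *)

Section Operators.

Variables (K : fieldType) (q : K).

Local Notation V := ((nat -> nat) -> K).

(* A polynomial of the quantum plane is represented by its coefficients: f c is
   the coefficient of the inversion-free monomial of multidegree c.  Then opL and
   opR are left and right multiplication by x_j. *)
Definition scl (a : K) (f : V) : V := fun c => a * f c.

Definition opL N j (f : V) : V := fun c =>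
  if (0 < c j)%N then q ^+ gts N j c * f (dec j c) else 0.
Definition opR j (f : V) : V := fun c =>
  if (0 < c j)%N then q ^+ lts j c * f (dec j c) else 0.

Definition rowL N (r : pred nat) (f : V) : V := \sum_(j < N | r j) opL N j f.
Definition rowR N (r : pred nat) (f : V) : V := \sum_(j < N | r j) opR j f.

Definition lin (op : V -> V) :=
  (forall f g, op (f + g) = op f + op g) /\
  (forall a f, op (scl a f) = scl a (op f)).

Lemma sclD a f g : scl a (f + g) = scl a f + scl a g.
Proof. by apply/funext => c; rewrite /scl !addrfctE mulrDr. Qed.

Lemma scl0 a : scl a 0 = 0.
Proof. by apply/funext => c; rewrite /scl mulr0. Qed.

Lemma scl_sum a I (s : seq I) P (F : I -> V) :
  scl a (\sum_(i <- s | P i) F i) = \sum_(i <- s | P i) scl a (F i).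
Proof. exact: (big_morph _ (sclD a) (scl0 a)). Qed.

Lemma lin0 op : lin op -> op 0 = 0.
Proof.
move=> [_ opZ]; have -> : 0 = scl 0 0 :> V by rewrite scl0.
by rewrite opZ; apply/funext => c; rewrite /scl !mul0r.
Qed.

Lemma lin_sum op I (s : seq I) P (F : I -> V) : lin op ->
  op (\sum_(i <- s | P i) F i) = \sum_(i <- s | P i) op (F i).
Proof. by move=> lop; apply: (big_morph op lop.1 (lin0 lop)). Qed.

Lemma lin_opL N j : lin (opL N j).
Proof.
split=> [f g | a f]; apply/funext => c; rewrite /opL /scl ?fctE;
  case: ifP => _; ring.
Qed.

Lemma lin_opR j : lin (opR j).
Proof.
split=> [f g | a f]; apply/funext => c; rewrite /opR /scl ?fctE;
  case: ifP => _; ring.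
Qed.

Lemma lin_rowL N r : lin (rowL N r).
Proof.
split=> [f g | a f]; rewrite /rowL ?scl_sum -?big_split;
  apply: eq_bigr => j _; [exact: (lin_opL N j).1 | exact: (lin_opL N j).2].
Qed.

Lemma lin_rowR N r : lin (rowR N r).
Proof.
split=> [f g | a f]; rewrite /rowR ?scl_sum -?big_split;
  apply: eq_bigr => j _; [exact: (lin_opR j).1 | exact: (lin_opR j).2].
Qed.

(** The relation x_i x_j = q x_j x_i: the two orders differ only in whether x_i has to pass the new
    x_j. *)
Lemma opLL N i j f : (i < j < N)%N ->
  opL N i (opL N j f) = scl q (opL N j (opL N i f)).
Proof.
move=> ijN; apply/funext => c; rewrite /opL /scl /=.
rewrite !dec_neq; [ | by lia | by lia].
case: ifP => ci; case: ifP => cj; rewrite ?mulr0 //.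
rewrite (gts_dec _ i cj) (gts_dec _ j ci) ijN ltnNge ltnW /= ?addn0; last by lia.
by rewrite decC exprD; ring.
Qed.

Lemma opRR i j f : (i < j)%N -> opR j (opR i f) = scl q (opR i (opR j f)).
Proof.
move=> ij; apply/funext => c; rewrite /opR /scl /=.
rewrite !dec_neq; [ | by lia | by lia].
case: ifP => cj; case: ifP => ci; rewrite ?mulr0 //.
rewrite (lts_dec j ci) (lts_dec i cj) ij ltnNge ltnW //= ?addn0.
by rewrite decC exprD; ring.
Qed.

(** Associativity of x_i f x_j. If i < j, the two new factors cross once in either order of
    multiplication, so both sides carry the same power of [q]. *)
Lemma opLR N i j f : (i < N)%N -> (j < N)%N ->
  opL N i (opR j f) = opR j (opL N i f).
Proof.
move=> iN jN; apply/funext => c; rewrite /opL /opR /=.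
case: (eqVneq i j) => [<- | ij].
  case: ifP => // ci; case: ifP => ci'; rewrite ?mulr0 //.
  by rewrite (gts_dec _ i ci) (lts_dec i ci) ltnn !addn0; ring.
rewrite !dec_neq // 1?eq_sym //.
case: ifP => ci; case: ifP => cj; rewrite ?mulr0 //.
by rewrite (gts_dec _ i cj) (lts_dec j ci) jN andbT decC !exprD; ring.
Qed.

Lemma rowLR N r r' f : rowL N r (rowR N r' f) = rowR N r' (rowL N r f).
Proof.
rewrite /rowL (eq_bigr (fun i : 'I_N => \sum_(j < N | r' j) opL N i (opR j f))).
  rewrite exchange_big; apply: eq_bigr => j _; rewrite (lin_sum _ _ _ (lin_opR j)).
  by apply: eq_bigr => i _; rewrite opLR.
by move=> i _; rewrite (lin_sum _ _ _ (lin_opL N i)).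
Qed.

Lemma rowLL N (r r' : pred nat) f :
    (forall i j, r i -> r' j -> (i < j)%N) ->
  rowL N r (rowL N r' f) = scl q (rowL N r' (rowL N r f)).
Proof.
move=> rr'; rewrite scl_sum /rowL.
rewrite (eq_bigr (fun i : 'I_N => \sum_(j < N | r' j) opL N i (opL N j f))).
  rewrite exchange_big; apply: eq_bigr => j r'j.
  rewrite (lin_sum _ _ _ (lin_opL N j)) scl_sum.
  by apply: eq_bigr => i ri; rewrite opLL // rr' /=.
by move=> i _; rewrite (lin_sum _ _ _ (lin_opL N i)).
Qed.

Lemma rowRR N (r r' : pred nat) f :
    (forall i j, r i -> r' j -> (i < j)%N) ->
  rowR N r' (rowR N r f) = scl q (rowR N r (rowR N r' f)).
Proof.
move=> rr'; rewrite scl_sum /rowR.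
rewrite (eq_bigr (fun i : 'I_N => \sum_(j < N | r j) opR i (opR j f))).
  rewrite exchange_big; apply: eq_bigr => j rj.
  rewrite (lin_sum _ _ _ (lin_opR j)) scl_sum.
  by apply: eq_bigr => i r'i; rewrite opRR // rr' /=.
by move=> i _; rewrite (lin_sum _ _ _ (lin_opR i)).
Qed.

(** * Products of rows *)

Definition delta0 N : V := fun c => (lts N c == 0)%N%:R.
(* Coefficients of the product of the rows, the top row being the left factor. *)
Definition W N (rows : seq (pred nat)) : V := foldr (rowL N) (delta0 N) rows.

Lemma lts_eq0 N c j : lts N c = 0%N -> (j < N)%N -> c j = 0%N.
Proof.
move=> /eqP; rewrite /lts sum_nat_eq0 => /forallP c0 jN.
by apply/eqP; have := c0 (Ordinal jN).
Qed.

Lemma opLR_delta N j : (j < N)%N -> opL N j (delta0 N) = opR j (delta0 N).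
Proof.
move=> jN; apply/funext => c; rewrite /opL /opR /delta0; case: ifP => // cj.
case: eqP => [c0 | _]; last by rewrite !mulr0.
rewrite (gts_dec _ j cj) (lts_dec j cj) ltnn !addn0.
have -> : gts N j (dec j c) = 0%N.
  by rewrite /gts big1 // => i _; apply: lts_eq0 c0 _.
by rewrite /lts big1 // => i _; apply: lts_eq0 c0 _; have := ltn_ord i; lia.
Qed.

Lemma rowLR_delta N r : rowL N r (delta0 N) = rowR N r (delta0 N).
Proof. by apply: eq_bigr => j _; rewrite opLR_delta. Qed.

Lemma W_cat N rows rows' : W N (rows ++ rows') = foldr (rowL N) (W N rows') rows.
Proof. exact: foldr_cat. Qed.

Lemma foldr_rowLR N rows r f :
  foldr (rowL N) (rowR N r f) rows = rowR N r (foldr (rowL N) f rows).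
Proof. by elim: rows => //= a rows ->; rewrite rowLR. Qed.

(** The bottom row acts on 1 in the same way from both sides, and right multiplication then commutes
    with all the rows above. *)
Lemma W_rcons N rows r : W N (rcons rows r) = rowR N r (W N rows).
Proof. by rewrite -cats1 W_cat /= rowLR_delta foldr_rowLR. Qed.

Lemma W_catR N rows rows' :
  W N (rows ++ rows') = foldl (fun f r => rowR N r f) (W N rows) rows'.
Proof.
by elim: rows' rows => [|a l IH] rows; rewrite ?cats0 //= -cat_rcons IH W_rcons.
Qed.

Lemma rowL_split N (u a b : pred nat) f :
    (forall j, (j < N)%N -> u j = a j || b j) ->
    (forall j, (j < N)%N -> ~~ (a j && b j)) ->
  rowL N u f = rowL N a f + rowL N b f.
Proof.
move=> uab abN; rewrite /rowL [LHS]big_mkcond.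
rewrite [X in X + _]big_mkcond [X in _ + X]big_mkcond -big_split.
apply: eq_bigr => j _ /=; rewrite uab //; have := abN j (ltn_ord j).
by case: (a j); case: (b j); rewrite ?addr0 ?add0r.
Qed.

Lemma rowR_split N (u a b : pred nat) f :
    (forall j, (j < N)%N -> u j = a j || b j) ->
    (forall j, (j < N)%N -> ~~ (a j && b j)) ->
  rowR N u f = rowR N a f + rowR N b f.
Proof.
move=> uab abN; rewrite /rowR [LHS]big_mkcond.
rewrite [X in X + _]big_mkcond [X in _ + X]big_mkcond -big_split.
apply: eq_bigr => j _ /=; rewrite uab //; have := abN j (ltn_ord j).
by case: (a j); case: (b j); rewrite ?addr0 ?add0r.
Qed.

Lemma rowL1 N t f : (t < N)%N -> rowL N (pred1 t) f = opL N t f.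
Proof.
by move=> tN; rewrite /rowL (big_pred1 (Ordinal tN)).
Qed.

Lemma rowR1 N t f : (t < N)%N -> rowR N (pred1 t) f = opR t f.
Proof.
by move=> tN; rewrite /rowR (big_pred1 (Ordinal tN)).
Qed.

End Operators.

(** * Insertion of a full row *)

Section Insertion.

Variables (K : fieldType) (q : K).

Local Notation V := ((nat -> nat) -> K).
Local Notation opL := (opL q).
Local Notation opR := (opR q).
Local Notation rowL := (rowL q).
Local Notation rowR := (rowR q).

Variables (N t : nat).
Hypothesis tN : (t < N)%N.

(* ddt is the q-derivative in t, up to the factor 1 - q. *)
Definition KS (f : V) : V := fun c => q ^+ gts N t c * f c.
Definition KP (f : V) : V := fun c => q ^+ lts t c * f c.
Definition ddt (f : V) : V := fun c => (1 - q ^+ (c t).+1) * f (inc t c).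

Lemma lin_KS : lin KS.
Proof. by split=> [f g|a f]; apply/funext => c; rewrite /KS /scl ?fctE; ring. Qed.

Lemma lin_KP : lin KP.
Proof. by split=> [f g|a f]; apply/funext => c; rewrite /KP /scl ?fctE; ring. Qed.

Lemma lin_ddt : lin ddt.
Proof. by split=> [f g|a f]; apply/funext => c; rewrite /ddt /scl ?fctE; ring. Qed.

Lemma row_lin (op : V -> V) (opj : nat -> V -> V) (r : pred nat) a f : lin op ->
    (forall j, (j < N)%N -> r j -> op (opj j f) = scl a (opj j (op f))) ->
  op (\sum_(j < N | r j) opj j f) = scl a (\sum_(j < N | r j) opj j (op f)).
Proof.
move=> lop H; rewrite (lin_sum _ _ _ lop) scl_sum.
by apply: eq_bigr => j rj; apply: H.
Qed.

Lemma KS_rowL (e : bool) (r : pred nat) f : (forall j, r j -> (t < j)%N = e) ->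
  KS (rowL N r f) = scl (q ^+ e) (rowL N r (KS f)).
Proof.
move=> re; apply: row_lin lin_KS _ => j jN /re <-.
apply/funext => c; rewrite /KS /opL /scl /=; case: ifP => cj; rewrite ?mulr0 //.
by rewrite (gts_dec _ t cj) jN andbT exprD; ring.
Qed.

Lemma KS_rowR (e : bool) (r : pred nat) f : (forall j, r j -> (t < j)%N = e) ->
  KS (rowR N r f) = scl (q ^+ e) (rowR N r (KS f)).
Proof.
move=> re; apply: row_lin lin_KS _ => j jN /re <-.
apply/funext => c; rewrite /KS /opR /scl /=; case: ifP => cj; rewrite ?mulr0 //.
by rewrite (gts_dec _ t cj) jN andbT exprD; ring.
Qed.

Lemma KP_rowL (e : bool) (r : pred nat) f : (forall j, r j -> (j < t)%N = e) ->
  KP (rowL N r f) = scl (q ^+ e) (rowL N r (KP f)).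
Proof.
move=> re; apply: row_lin lin_KP _ => j jN /re <-.
apply/funext => c; rewrite /KP /opL /scl /=; case: ifP => cj; rewrite ?mulr0 //.
by rewrite (lts_dec t cj) exprD; ring.
Qed.

Lemma KP_rowR (e : bool) (r : pred nat) f : (forall j, r j -> (j < t)%N = e) ->
  KP (rowR N r f) = scl (q ^+ e) (rowR N r (KP f)).
Proof.
move=> re; apply: row_lin lin_KP _ => j jN /re <-.
apply/funext => c; rewrite /KP /opR /scl /=; case: ifP => cj; rewrite ?mulr0 //.
by rewrite (lts_dec t cj) exprD; ring.
Qed.

(** Before the derivative lowers the degree in x_t there is one more x_t to pass, which costs [q]
    exactly when [j] is left of [t]. *)
Lemma ddt_rowL (e : bool) (r : pred nat) f :
    (forall j, r j -> j != t /\ (j < t)%N = e) ->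
  ddt (rowL N r f) = scl (q ^+ e) (rowL N r (ddt f)).
Proof.
move=> re; apply: row_lin lin_ddt _ => j jN /re[jt <-].
apply/funext => c; rewrite /ddt /opL /scl /=.
rewrite {1}/inc (negPf jt) addn0; case: ifP => cj; rewrite ?mulr0 //.
rewrite gts_inc tN andbT exprD dec_inc // dec_neq 1?eq_sym //; ring.
Qed.

Lemma ddt_rowR (e : bool) (r : pred nat) f :
    (forall j, r j -> j != t /\ (t < j)%N = e) ->
  ddt (rowR N r f) = scl (q ^+ e) (rowR N r (ddt f)).
Proof.
move=> re; apply: row_lin lin_ddt _ => j jN /re[jt <-].
apply/funext => c; rewrite /ddt /opR /scl /=.
rewrite {1}/inc (negPf jt) addn0; case: ifP => cj; rewrite ?mulr0 //.
rewrite lts_inc exprD dec_inc // dec_neq 1?eq_sym //; ring.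
Qed.

(** Twisted Leibniz rule, from 1 - q^(a+1) = q (1 - q^a) + (1 - q); [KS] records the variables that
    the new x_t passes. *)
Lemma ddt_opL f :
  ddt (opL N t f) = scl q (opL N t (ddt f)) + scl (1 - q) (KS f).
Proof.
apply/funext => c; rewrite fctE /ddt /opL /scl /KS /=.
rewrite {1}/inc eqxx addn1 /= incK gts_inc ltnn addn0; case: ifP => ct.
  rewrite decK // /dec eqxx subn1 prednK // !exprS; ring.
have -> : c t = 0%N by lia.
by ring.
Qed.

Lemma ddt_opR f :
  ddt (opR t f) = scl q (opR t (ddt f)) + scl (1 - q) (KP f).
Proof.
apply/funext => c; rewrite fctE /ddt /opR /scl /KP /=.
rewrite {1}/inc eqxx addn1 /= incK lts_inc ltnn addn0; case: ifP => ct.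
  rewrite decK // /dec eqxx subn1 prednK // !exprS; ring.
have -> : c t = 0%N by lia.
by ring.
Qed.

(** Either way, x_t is put in place at the cost of one [q] for each variable of another column. *)
Lemma opR_KS f : opR t (KS f) = opL N t (KP f).
Proof.
apply/funext => c; rewrite /opR /opL /KS /KP; case: ifP => // ct.
by rewrite (gts_dec _ t ct) (lts_dec t ct) !ltnn !addn0; ring.
Qed.

(** The derivative term corrects [KS] so that it commutes with left multiplication by rows
    containing all columns from [t] on; [Phi] is built from it so as to commute with the
    corresponding right multiplications too. *)
Definition Psi (f : V) : V := KS f + rowL N (fun j => t < j)%N (ddt f).
Definition Phi (f : V) : V :=
  rowR N (fun j => j < t)%N (Psi f) + KP (rowL N (fun j => t <= j)%N f).

Lemma scl1 (f : V) : scl 1 f = f.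
Proof. by apply/funext => c; rewrite /scl mul1r. Qed.

Lemma rowL_split3 (u : pred nat) f :
  (forall j, (t <= j)%N -> u j) ->
  rowL N u f = rowL N (fun j => u j && (j < t))%N f + opL N t f
               + rowL N (fun j => t < j)%N f.
Proof.
move=> ut; rewrite -(rowL1 q _ tN) -addrA -(@rowL_split _ _ _ (fun j => t <= j)%N).
- apply: rowL_split => j _; have := ut j; case: ltnP => _; rewrite ?andbT ?orbF ?andbF //.
  by move->.
- by move=> j _ /=; rewrite leq_eqVlt eq_sym.
- by move=> j _ /=; case: eqP => // ->; rewrite ltnn.
Qed.

Lemma rowR_split3 (v : pred nat) f :
  (forall j, (j <= t)%N -> v j) ->
  rowR N v f = rowR N (fun j => j < t)%N f + opR t f
               + rowR N (fun j => v j && (t < j))%N f.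
Proof.
move=> vt; rewrite -(rowR1 q _ tN) -(@rowR_split _ _ _ (fun j => j <= t)%N).
- apply: rowR_split => j _; have := vt j; case: leqP => _; rewrite ?andbT ?orbF ?andbF //.
  by move->.
- by move=> j _ /=; rewrite leq_eqVlt orbC.
- by move=> j _ /=; case: eqP => [->|]; rewrite ?ltnn ?andbF.
Qed.

(** Write the row as U + t + S. [KS] turns S f into q S (KS f), and the Leibniz rule supplies the
    missing (1 - q) S (KS f). The derivative terms agree because U S = q S U and t S = q S t. *)
Lemma Psi_rowL (u : pred nat) f : (forall j, (t <= j)%N -> u j) ->
  Psi (rowL N u f) = rowL N u (Psi f).
Proof.
move=> ut; rewrite !(rowL_split3 _ ut) /Psi.
have lS := lin_rowL q N (fun j => t < j)%N.
have lP := lin_rowL q N (fun j => u j && (j < t))%N.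
have lT := lin_opL q N t.
rewrite !lin_KS.1 !lin_ddt.1 -!(rowL1 q _ tN).
rewrite (KS_rowL (e := false)); last by move=> j /andP[_ /ltnW]; rewrite leqNgt => /negPf.
rewrite (@KS_rowL false (pred1 t)); last by move=> j /eqP->; rewrite ltnn.
rewrite (@KS_rowL true) //.
rewrite (@ddt_rowL true); last by move=> j /andP[_ jt]; rewrite neq_ltn jt.
rewrite (@ddt_rowL false (fun j => t < j)%N); last first.
  by move=> j tj; rewrite neq_ltn tj orbT; split=> //; apply/negbTE; rewrite -leqNgt ltnW.
rewrite !rowL1 // ddt_opL !lS.1 !lS.2 !lP.1 !lT.1.
rewrite (@rowLL _ q N (fun j => u j && (j < t))%N (fun j => t < j)%N); last first.
  by move=> i j /andP[_ it] tj; lia.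
rewrite -!(rowL1 q _ tN) (@rowLL _ q N (pred1 t) (fun j => t < j)%N); last first.
  by move=> i j /eqP->.
rewrite expr0 expr1 !scl1; apply/funext => c; rewrite !fctE /scl; ring.
Qed.

(** The first term reduces to [Psi_rowL], as left and right multiplications commute. In the second,
    [KP] costs [q] on the part U of the row left of [t], which U (t + S) = q (t + S) U absorbs. *)
Lemma Phi_rowL (u : pred nat) f : (forall j, (t <= j)%N -> u j) ->
  Phi (rowL N u f) = rowL N u (Phi f).
Proof.
move=> ut; rewrite /Phi Psi_rowL // (lin_rowL q N u).1 rowLR; congr (_ + _).
have KZ g : KP (rowL N (fun j => t <= j)%N g) = rowL N (fun j => t <= j)%N (KP g).
  rewrite (@KP_rowL false) ?expr0 ?scl1 // => j tj; apply/negbTE; by rewrite -leqNgt.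
have split g : rowL N u g
    = rowL N (fun j => u j && (j < t))%N g + rowL N (fun j => t <= j)%N g.
  apply: rowL_split => j _; have := ut j; case: ltnP => _;
  by rewrite ?andbT ?orbF ?andbF // => ->.
rewrite !KZ !split.
rewrite lin_KP.1 KZ (@KP_rowL true) ?expr1; last by move=> j /andP[].
rewrite (lin_rowL q N _).1 (lin_rowL q N _).2; congr (_ + _).
by rewrite [RHS]rowLL // => i j /andP[_ it]; apply: leq_trans.
Qed.

(** The two terms of [Phi] fail to commute by opposite amounts: the first by (1 - q) ((KS f) t + S
    (KP f)) P, from the Leibniz rule, the second by -(1 - q) KP((t + S) f) P. *)
Lemma Phi_rowR (v : pred nat) f : (forall j, (j <= t)%N -> v j) ->
  Phi (rowR N v f) = rowR N v (Phi f).
Proof.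
move=> vt; rewrite /Phi /Psi !(rowR_split3 _ vt).
have lS := lin_rowL q N (fun j => t < j)%N.
have lZ := lin_rowL q N (fun j => t <= j)%N.
have lP := lin_rowR q N (fun j => j < t)%N.
have lV := lin_rowR q N (fun j => v j && (t < j))%N.
have lT := lin_opR q t.
rewrite !lin_KS.1 !lin_ddt.1 -!(rowR1 q _ tN).
have ltF j : (j < t)%N -> (t < j)%N = false by move=> /ltnW; rewrite leqNgt => /negPf.
rewrite (@KS_rowR false) //.
rewrite (@KS_rowR false (pred1 t)); last by move=> j /eqP->; rewrite ltnn.
rewrite (@KS_rowR true (fun j => v j && (t < j))%N); last by move=> j /andP[].
rewrite (@ddt_rowR false); last by move=> j jt; rewrite neq_ltn jt; split=> //; apply: ltF.
rewrite (@ddt_rowR true (fun j => v j && (t < j))%N); last first.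
  by move=> j /andP[_ tj]; rewrite neq_ltn tj orbT.
rewrite !lZ.1 !lin_KP.1 !rowLR.
rewrite (@KP_rowR true (fun j => j < t)%N) //.
rewrite (@KP_rowR false (pred1 t)); last by move=> j /eqP->; rewrite ltnn.
rewrite (@KP_rowR false (fun j => v j && (t < j))%N); last first.
  by move=> j /andP[_ tj]; apply/negbTE; rewrite -leqNgt ltnW.
rewrite !rowR1 // ddt_opR !lS.1 !lS.2 -?(rowR1 q _ tN) !rowLR.
rewrite expr0 expr1 !scl1 !lP.1 !lP.2 ?lV.1 ?(lin_rowR q N (pred1 t)).1.
have PV g := @rowRR _ q N (fun j => j < t)%N (fun j => v j && (t < j))%N g
  (fun i j it vj => ltn_trans it (andP vj).2).
have PT g : rowR N (pred1 t) (rowR N (fun j => j < t)%N g)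
    = scl q (rowR N (fun j => j < t)%N (rowR N (pred1 t) g)).
  by apply: rowRR => i j it /eqP->.
rewrite !PV !PT.
(* The identity that makes the two defects cancel; its t part is [opR_KS]. *)
have key : rowR N (pred1 t) (KS f) + rowL N (fun j => t < j)%N (KP f)
    = KP (rowL N (fun j => t <= j)%N f).
  rewrite (@KP_rowL false) ?expr0 ?scl1; last first.
    by move=> j tj; apply/negbTE; rewrite -leqNgt.
  rewrite rowR1 // opR_KS -(rowL1 q _ tN) -(@rowL_split _ q _ (fun j => t <= j)%N) //.
    by move=> j _ /=; rewrite leq_eqVlt eq_sym.
  by move=> j _ /=; case: eqP => // ->; rewrite ltnn.
have {key} := congr1 (rowR N (fun j => j < t)%N) key.
rewrite lP.1 => key.
apply/funext => c; have := congr1 (@^~ c) key; rewrite !fctE /scl => <-; ring.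
Qed.

Lemma gts_eq0 c j : lts N c = 0%N -> gts N j c = 0%N.
Proof. by move=> c0; rewrite /gts big1 // => i _; apply: lts_eq0 c0 _. Qed.

Lemma lts_eq0_le c : lts N c = 0%N -> lts t c = 0%N.
Proof.
move=> c0; rewrite /lts big1 // => i _; apply: lts_eq0 c0 _.
exact: ltn_trans tN.
Qed.

Lemma Phi_delta : Phi (delta0 K N) = rowL N predT (delta0 K N).
Proof.
have KPd : KP (delta0 K N) = delta0 K N.
  apply/funext => c; rewrite /KP /delta0; case: eqP => [c0|_]; last by rewrite mulr0.
  by rewrite lts_eq0_le // mul1r.
have KSd : KS (delta0 K N) = delta0 K N.
  apply/funext => c; rewrite /KS /delta0; case: eqP => [c0|_]; last by rewrite mulr0.
  by rewrite gts_eq0 // mul1r.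
have dd : ddt (delta0 K N) = 0.
  apply/funext => c; rewrite /ddt /delta0 lts_inc tN addn1 /= mulr0 //.
rewrite /Phi /Psi KSd dd (lin0 (lin_rowL _ _ _)) addr0 (@KP_rowL false) => [|j tj].
  rewrite expr0 scl1 KPd -rowLR_delta; apply: esym; apply: rowL_split => j _ /=.
    by case: ltnP.
  by rewrite ltnNge; case: (t <= j)%N.
by apply/negbTE; rewrite -leqNgt.
Qed.

(** The rows of [a] are pulled out of [Phi] on the left and those of [b] on the right. What remains
    is [Phi] of 1, a full row standing between them. *)
Lemma Phi_W (u : nat -> pred nat) (a b : seq nat) :
    {in a, forall i j, (t <= j)%N -> u i j} ->
    {in b, forall i j, (j <= t)%N -> u i j} ->
  Phi (W q N (map u a ++ map u b)) = W q N (map u a ++ (predT : pred nat) :: map u b).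
Proof.
elim: a => [_ | i a IH Ha Hb] /=; last first.
  rewrite Phi_rowL; last by apply: Ha; apply: mem_head.
  by rewrite IH // => k ka; apply: Ha; rewrite in_cons ka orbT.
elim/last_ind: b => [_ | b i IH Hb]; first exact: Phi_delta.
rewrite map_rcons W_rcons Phi_rowR; last by apply: Hb; rewrite mem_rcons mem_head.
rewrite IH; last by move=> k kb; apply: Hb; rewrite mem_rcons in_cons kb orbT.
by rewrite rowLR.
Qed.

End Insertion.

(** * Merging two adjacent columns *)

Section Merge.

Variables (K : fieldType) (q : K).

Local Notation V := ((nat -> nat) -> K).
Local Notation opL := (opL q).
Local Notation opR := (opR q).
Local Notation rowL := (rowL q).
Local Notation rowR := (rowR q).

Variables (N t : nat).
Hypothesis tN : (t < N)%N.

(* Columns x = t and y = t+1 out of N.+1 are merged into column t out of N.  As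
   xy = q yx, the coefficient of y^b x^a in (x + y)^(a + b) is qB a b, and
   iota_mrg substitutes x + y for the merged variable. *)
Fixpoint qB a b : K :=
  if a is a'.+1 then
    (fix qB' b := if b is b'.+1 then q ^+ b * qB a' b + qB' b' else 1) b
  else 1.

Lemma qB0 a : qB a 0 = 1. Proof. by case: a. Qed.

(** [bump t.+1] numbers the columns other than y, and gives x the index [t] of the merged column. *)
Definition drp (c : nat -> nat) : nat -> nat := fun i => c (bump t.+1 i).
Definition mrg (c : nat -> nat) : nat -> nat :=
  fun i => (c (bump t.+1 i) + (i == t) * c t.+1)%N.

Definition iota_mrg (w : V) : V := fun c => qB (c t) (c t.+1) * w (mrg c).

Lemma bump_le i : (i <= t)%N -> bump t.+1 i = i.
Proof. by rewrite /bump; lia. Qed.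

Lemma bump_gt i : (t < i)%N -> bump t.+1 i = i.+1.
Proof. by rewrite /bump; lia. Qed.

Lemma sum_drp (p : pred nat) (c : nat -> nat) :
  (\sum_(i < N.+1 | p i) c i
   = p t.+1 * c t.+1 + \sum_(i < N | p (bump t.+1 i)) drp c i)%N.
Proof.
have tN1 : (t.+1 < N.+1)%N by lia.
case pt: (p t.+1).
  by rewrite (bigD1_ord (Ordinal tN1)) //= mul1n.
by rewrite big_mkcond (bigD1_ord (Ordinal tN1)) //= pt add0n [RHS]big_mkcond.
Qed.

Lemma sum_mrg (p : pred nat) (c : nat -> nat) :
  (\sum_(i < N | p i) mrg c i = \sum_(i < N | p i) drp c i + p t * c t.+1)%N.
Proof.
rewrite big_split /=; congr (_ + _)%N.
rewrite -big_distrl /= (eq_bigr (fun i : 'I_N => (i == t :> nat) : nat)) //.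
by rewrite sum_pred1 tN.
Qed.

Lemma gts_lt j c : (j < t)%N -> gts N.+1 j c = gts N j (mrg c).
Proof.
move=> jt; rewrite /gts sum_drp sum_mrg addnC; congr (_ + _)%N; last by lia.
by apply: eq_bigl => i; rewrite /bump; lia.
Qed.

Lemma gts_gt j c : (t <= j)%N -> gts N.+1 j.+1 c = gts N j (drp c).
Proof.
move=> tj; rewrite /gts sum_drp (_ : (j.+1 < t.+1)%N = false) ?mul0n ?add0n; last by lia.
by apply: eq_bigl => i; rewrite /bump; lia.
Qed.

Lemma gts_mrg j c : (t <= j)%N -> gts N j (mrg c) = gts N j (drp c).
Proof.
by move=> tj; rewrite /gts sum_mrg (_ : (j < t)%N = false) ?addn0 //; lia.
Qed.

Lemma gts_t c : gts N.+1 t c = (c t.+1 + gts N t (drp c))%N.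
Proof.
rewrite /gts sum_drp ltnSn mul1n; congr (_ + _)%N.
by apply: eq_bigl => i; rewrite /bump; lia.
Qed.

Lemma lts_drp j c : (j <= t)%N -> lts j (drp c) = lts j c.
Proof.
by move=> jt; apply: eq_bigr => i _; rewrite /drp bump_le //; have := ltn_ord i; lia.
Qed.

Lemma lts_mrg j c : (j <= t)%N -> lts j (mrg c) = lts j c.
Proof.
move=> jt; apply: eq_bigr => i _; have := ltn_ord i => ij.
by rewrite /mrg bump_le; lia.
Qed.

Lemma drp_dec j c : drp (dec (bump t.+1 j) c) = dec j (drp c).
Proof.
by apply/funext => i; rewrite /drp /dec (inj_eq (can_inj (bumpK _))).
Qed.

Lemma mrg_dec j c : j != t -> mrg (dec (bump t.+1 j) c) = dec j (mrg c).
Proof.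
move=> jt; apply/funext => i; rewrite /mrg /dec (inj_eq (can_inj (bumpK _))).
rewrite (negPf (neq_bump _ _)) subn0.
by case: (eqVneq i j) => [-> | _]; rewrite ?(negPf jt) ?subn0 ?mul0n ?addn0.
Qed.

Lemma mrg_dec_x c : (0 < c t)%N -> mrg (dec t c) = dec t (mrg c).
Proof.
move=> ct; apply/funext => i; rewrite /mrg /dec; case: (eqVneq i t) => [-> | it].
  rewrite bump_le // eqxx; lia.
rewrite mul0n !addn0 subn0 (_ : _ == t = false) ?subn0 //.
by rewrite /bump; lia.
Qed.

Lemma mrg_dec_y c : (0 < c t.+1)%N -> mrg (dec t.+1 c) = dec t (mrg c).
Proof.
move=> ct; apply/funext => i; rewrite /mrg /dec [_ == t.+1]eq_sym (negPf (neq_bump _ _)).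
rewrite eqxx subn0; case: (i == t); lia.
Qed.

Lemma lin_iota : lin iota_mrg.
Proof.
by split=> [f g|a f]; apply/funext => c; rewrite /iota_mrg /scl ?fctE; ring.
Qed.

Lemma mrg_neq j c : j != t -> mrg c j = c (bump t.+1 j).
Proof. by move=> /negPf jt; rewrite /mrg jt addn0. Qed.

(** Substituting x + y respects multiplication. For j = t this is the recursion of [qB]: a leading x
    pays q^b to pass y^b, a leading y pays nothing. Any other x_j passes equally many variables
    before and after merging. *)
Lemma opL_iota j w : (j < N)%N ->
  opL N.+1 (bump t.+1 j) (iota_mrg w)
  + (if j == t then opL N.+1 t.+1 (iota_mrg w) else 0)
  = iota_mrg (opL N j w).
Proof.
move=> jN; apply/funext => c; rewrite fctE.
case: (eqVneq j t) => [-> | jt].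
  have mt : mrg c t = (c t + c t.+1)%N by rewrite /mrg bump_le // eqxx mul1n.
  have ty : (t == t.+1) = false by lia.
  have yt : (t.+1 == t) = false by lia.
  rewrite bump_le // /iota_mrg /opL /= mt gts_t gts_gt // gts_mrg // addn_gt0.
  have dt : dec t c t = (c t).-1 by rewrite /dec eqxx subn1.
  have dy : dec t.+1 c t.+1 = (c t.+1).-1 by rewrite /dec eqxx subn1.
  rewrite dt dy !dec_neq ?ty ?yt //.
  have := @mrg_dec_x c; have := @mrg_dec_y c; rewrite exprD.
  case: (c t) => [|a]; case: (c t.+1) => [|b] /=.
  - by move=> _ _; rewrite mulr0 addr0.
  - by move=> -> // _; ring.
  - by move=> _ -> //; rewrite !qB0; ring.
  - by move=> -> // -> //; ring.
rewrite addr0 /iota_mrg /opL /= mrg_neq //; case: ifP => cj; last by rewrite mulr0.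
rewrite mrg_dec // !dec_neq ?neq_bump // 1?eq_sym; last first.
  by rewrite /bump; lia.
have -> : gts N.+1 (bump t.+1 j) c = gts N j (mrg c); last by ring.
have [jlt | tj] := ltnP j t; first by rewrite bump_le ?gts_lt // ltnW.
by rewrite bump_gt ?gts_gt ?gts_mrg //; lia.
Qed.

Definition mrow (r : pred nat) : pred nat := fun j => r (bump t.+1 j).

Lemma rowL_iota (r : pred nat) w : r t = r t.+1 ->
  rowL N.+1 r (iota_mrg w) = iota_mrg (rowL N (mrow r) w).
Proof.
move=> rt; have tN1 : (t.+1 < N.+1)%N by lia.
rewrite (lin_sum _ _ _ lin_iota) /rowL big_mkcond (bigD1_ord (Ordinal tN1)) //=.
rewrite [RHS](eq_bigr (fun j : 'I_N => opL N.+1 (bump t.+1 j) (iota_mrg w) +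
  (if j == t :> nat then opL N.+1 t.+1 (iota_mrg w) else 0))); last first.
  by move=> j _; rewrite opL_iota.
rewrite big_split /= addrC; congr (_ + _); first by rewrite [RHS]big_mkcond.
rewrite -big_mkcondr /=; case: ifP => ry.
  rewrite (big_pred1 (Ordinal tN)) // => j /=; rewrite -val_eqE /= andbC.
  by case: eqP => // ->; rewrite /mrow bump_le // rt ry.
rewrite big1 // => j /andP[+ /eqP jt].
by rewrite jt /mrow bump_le // rt ry.
Qed.

Lemma opR_iota j w : (j < t)%N -> opR j (iota_mrg w) = iota_mrg (opR j w).
Proof.
move=> jt; apply/funext => c; rewrite /iota_mrg /opR /=.
have jt' := ltnW jt; have jnt : j != t by lia.
have jny : j != t.+1 by lia.
rewrite mrg_neq // bump_le //; case: ifP => cj; last by rewrite mulr0.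
rewrite lts_mrg // !dec_neq 1?eq_sym // -(mrg_dec _ jnt) bump_le //.
by ring.
Qed.

Lemma row_low (F : nat -> V) (r : pred nat) : (forall j, r j -> (j < t)%N) ->
  \sum_(j < N.+1 | r j) F j = \sum_(j < N | r j) F j.
Proof.
move=> rt; rewrite big_mkcond big_ord_recr /= -big_mkcond.
by case: ifP => [/rt|]; rewrite ?addr0 //; lia.
Qed.

Lemma rowR_iota (r : pred nat) w : (forall j, r j -> (j < t)%N) ->
  rowR N.+1 r (iota_mrg w) = iota_mrg (rowR N r w).
Proof.
move=> rt; rewrite (lin_sum _ _ _ lin_iota).
apply: etrans (row_low (fun j => opR j (iota_mrg w)) rt) _.
by apply: eq_bigr => j /rt /opR_iota.
Qed.

Lemma W_iota (u : nat -> pred nat) (s : seq nat) : {in s, forall i, u i t = u i t.+1} ->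
  W q N.+1 (map u s) = iota_mrg (W q N (map (mrow \o u) s)).
Proof.
elim: s => [_ | i s IH Hs] /=.
  apply/funext => c; rewrite /iota_mrg /delta0.
  have -> : lts N.+1 c = lts N (mrg c).
    rewrite /lts (sum_drp predT) (sum_mrg predT) /=; lia.
  case: eqP => [c0 | _]; last by rewrite mulr0.
  have := lts_eq0 c0 tN; rewrite /mrg bump_le // eqxx mul1n => /eqP.
  by rewrite addn_eq0 => /andP[/eqP-> /eqP->] /=; rewrite mulr1.
rewrite IH => [|k ks]; last by apply: Hs; rewrite in_cons ks orbT.
by rewrite rowL_iota //; apply: Hs; apply: mem_head.
Qed.

(* f is q^(S-degree - k) times g; the offset k counts the rows already multiplied
   on the left of f. *)
Definition scaled (k : nat) (f g : V) := forall c, c t = 2%N -> c t.+1 = 2%N ->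
  f c * q ^+ k = q ^+ gts N.+1 t.+1 c * g (drp c).

(** A factor right of y raises the degree in S by one, which the offset absorbs; the variables it
    passes are unaffected by the removal of column y. *)
Lemma scaled_rowL k (r : pred nat) f g : (forall j, r j -> (t.+1 < j)%N) ->
  scaled k f g -> scaled k.+1 (rowL N.+1 r f) (rowL N (mrow r) g).
Proof.
move=> rt fg c ct cy; rewrite /rowL !fct_sumE.
have tN1 : (t.+1 < N.+1)%N by lia.
rewrite big_mkcond (bigD1_ord (Ordinal tN1)) //=.
have -> : r t.+1 = false by apply/negbTE/negP => /rt; rewrite ltnn.
rewrite add0r -big_mkcond mulr_suml mulr_sumr; apply: eq_bigr => j rj.
have tj : (t < j)%N by have := rt _ rj; rewrite /bump; lia.
rewrite /opL /= bump_gt // -[c j.+1]/(c (1 + j)%N) -/(drp c j).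
have -> : drp c j = c j.+1 by rewrite /drp bump_gt.
case: ifP => cj; last by rewrite mul0r mulr0.
rewrite (gts_gt c (ltnW tj)) exprS.
have := fg (dec j.+1 c); rewrite !dec_neq; [|lia|lia].
move=> /(_ ct cy) fgd; rewrite mulrACA fgd.
have -> : drp (dec j.+1 c) = dec j (drp c) by rewrite -{1}(bump_gt tj) drp_dec.
rewrite (gts_dec _ t.+1 cj).
have -> : (t.+1 < j.+1 < N.+1)%N = true by have := ltn_ord j; lia.
rewrite exprD; ring.
Qed.

Lemma scaled_rowR k (r : pred nat) f g : (forall j, r j -> (j < t)%N) ->
  scaled k f g -> scaled k (rowR N.+1 r f) (rowR N r g).
Proof.
move=> rt fg c ct cy; rewrite /rowR !fct_sumE.
rewrite (_ : \sum_(i < N.+1 | r i) opR i f c = \sum_(i < N | r i) opR i f c); last first.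
  rewrite big_mkcond big_ord_recr /= -big_mkcond.
  by case: ifP => [/rt|]; rewrite ?addr0 //; lia.
rewrite mulr_suml mulr_sumr; apply: eq_bigr => j /rt jt.
rewrite /opR /= lts_drp; last exact: ltnW.
have -> : drp c j = c j by rewrite /drp bump_le // ltnW.
case: ifP => cj; last by rewrite mul0r mulr0.
have := fg (dec j c); rewrite !dec_neq; [|lia|lia].
move=> /(_ ct cy) fgd; rewrite -mulrA fgd.
have -> : drp (dec j c) = dec j (drp c).
  by rewrite -{1}(bump_le (ltnW jt)) drp_dec.
rewrite (gts_dec _ t.+1 cj).
have -> : (t.+1 < j < N.+1)%N = false by lia.
by rewrite addn0; ring.
Qed.

Lemma scaledD k f f' g g' :
  scaled k f g -> scaled k f' g' -> scaled k (f + f') (g + g').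
Proof. by move=> fg fg' c ct cy; rewrite !fctE mulrDl mulrDr fg // fg'. Qed.

Lemma eq_rowL M (r r' : pred nat) f : (forall j, (j < M)%N -> r j = r' j) ->
  rowL M r f = rowL M r' f.
Proof. by move=> rr'; apply: eq_bigl => j; apply: rr'. Qed.

Lemma right_factor w c :
  (opR t (iota_mrg w) + rowR N.+1 (fun j => j < t)%N (iota_mrg w)) c =
  (if (0 < c t)%N then q ^+ lts t c * (qB (c t).-1 (c t.+1) * w (dec t (mrg c)))
   else 0) + qB (c t) (c t.+1) * rowR N (fun j => j < t)%N w (mrg c).
Proof.
rewrite rowR_iota // fctE; congr (_ + _); rewrite /opR /iota_mrg /=.
case: ifP => // ct; rewrite mrg_dec_x // (@dec_neq t.+1 t); last by lia.
by rewrite /dec eqxx subn1.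
Qed.

(** Of the four dots in x and y three remain, one more than [drp c] has in column [t]. *)
Lemma mrg_dec2 j c : c t = 2%N -> c t.+1 = 2%N -> (j == t) || (j == t.+1) ->
  mrg (dec j c) = inc t (drp c).
Proof.
move=> ct cy jt; have -> : mrg (dec j c) = dec t (mrg c).
  by case/orP: jt => /eqP->; [apply: mrg_dec_x | apply: mrg_dec_y]; lia.
apply/funext => i; rewrite /dec /inc /mrg /drp cy.
by case: (i == t); rewrite ?mul1n ?mul0n ?addn0 ?subn0 // addn2 addn1 subn1.
Qed.

Lemma lts_dec_ge j c : (t <= j)%N -> lts t (dec j c) = lts t c.
Proof.
move=> tj; apply: eq_bigr => i _; rewrite dec_neq // neq_ltn.
by rewrite (leq_trans (ltn_ord i) tj).
Qed.

Lemma gts_dec_le M k j c : (j <= k)%N -> gts M k (dec j c) = gts M k c.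
Proof.
move=> jk; apply: eq_bigr => i ki; rewrite dec_neq // neq_ltn.
by rewrite (leq_ltn_trans jk ki) orbT.
Qed.

Hypothesis q0 : q != 0.

(** With G = [iota_mrg w], this extracts the coefficient of y^2 x^2 from (y^2 + S(qy - x)) G (x +
    P). *)
Lemma scaled_Phi w :
  let f := opR t (iota_mrg w) + rowR N.+1 (fun j => j < t)%N (iota_mrg w) in
  scaled 0 (opL N.+1 t.+1 (opL N.+1 t.+1 f)
            + rowL N.+1 (fun j => t.+1 < j)%N
                (scl q (opL N.+1 t.+1 f) - opL N.+1 t f))
    (Phi q N t w).
Proof.
move=> f; pose P := fun j => (j < t)%N; pose S := fun j => (t < j)%N.
(* Regroup [Phi] into the part that comes from y^2 and the part that comes from S(qy - x). *)
have -> : Phi q N t w = (KS q N t (rowR N P w) + opL N t (KP q t w))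
    + rowL N S (KP q t w + ddt q t (rowR N P w)).
  rewrite /Phi /Psi (lin_rowR q N _).1 -rowLR.
  rewrite (@KS_rowR _ q N t false) ?expr0 ?scl1; last first.
    by move=> j; rewrite /P => /ltnW; rewrite leqNgt => /negPf.
  rewrite (@ddt_rowR _ q N t false P) ?expr0 ?scl1; last first.
    rewrite /P => j jt; rewrite neq_ltn jt; split=> //.
    by move: jt => /ltnW; rewrite leqNgt => /negPf.
  rewrite (@KP_rowL _ q N t false) ?expr0 ?scl1; last by move=> j tj; lia.
  rewrite (rowL_split3 q tN (u := fun j => t <= j)%N) //.
  rewrite (@eq_rowL N (fun j => (t <= j) && (j < t))%N pred0); last first.
    by move=> j _; rewrite ltnNge andbN.
  rewrite [rowL N pred0 _]big_pred0 // add0r (lin_rowL q N _).1.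
  apply/funext => c; rewrite !fctE; ring.
apply: scaledD.
  move=> c ct cy; rewrite expr0 mulr1 fctE.
  (* Once y^2 is taken off, no y is left, so every [qB] that occurs is 1. *)
  have cyy : dec t.+1 c t.+1 = 1%N by rewrite /dec eqxx cy.
  have ytF : (t == t.+1) = false by lia.
  rewrite /opL /= cy cyy /= /f right_factor; set c2 := dec _ (dec _ c).
  have c2t : c2 t = 2%N by rewrite /c2 !dec_neq ?ytF.
  have c2y : c2 t.+1 = 0%N by rewrite /c2 {1}/dec eqxx cyy.
  have dt : drp c t = 2%N by rewrite /drp bump_le.
  have mc : mrg c2 = drp c.
    rewrite /c2 mrg_dec_y ?cyy // mrg_dec2 ?eqxx ?orbT // incK //.
  have lc : lts t c2 = lts t c.
    by rewrite /c2 !lts_dec_ge.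
  rewrite c2t c2y mc lc dt /= !mul1r /KS /KP.
  rewrite lts_dec_ge // lts_drp // !gts_dec_le // !gts_gt //.
  by rewrite /P; ring.
(* Up to the common powers, P contributes (q - q^2)(1 + q + q^2) = q (1 - q^3), the factor in [ddt]
   at degree 2, and x contributes q (1 + q) - q^2 = q. *)
have H : scaled 0 (scl q (opL N.+1 t.+1 f) - opL N.+1 t f)
    (scl q (KP q t w + ddt q t (rowR N P w))).
  move=> c ct cy; rewrite expr0 mulr1.
  have cyy : dec t.+1 c t.+1 = 1%N by rewrite /dec eqxx cy.
  have ctt : dec t c t = 1%N by rewrite /dec eqxx ct.
  have ytF : (t == t.+1) = false by lia.
  have tyF : (t.+1 == t) = false by lia.
  rewrite !fctE /scl /opL ct cy /= /f !right_factor.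
  rewrite cyy ctt !dec_neq ?ytF ?tyF // ct cy /= !(mrg_dec2 ct cy) ?eqxx ?orbT // incK.
  have dt : drp c t = 2%N by rewrite /drp bump_le.
  rewrite !lts_dec_ge // gts_t gts_gt // cy /KP /ddt lts_drp // dt exprD /P; ring.
(* Multiplying by S raises the offset to 1; the extra factor [q] in [H] brings it back to 0. *)
move=> c ct cy; have := scaled_rowL (r := fun j => (t.+1 < j)%N) (fun j h => h) H ct cy.
rewrite (lin_rowL q N _).2 expr1 expr0 mulr1 mulrC /scl mulrCA => /(mulfI q0) ->.
congr (_ * _); congr (_ _); apply: eq_rowL => j _.
by rewrite /mrow /S /bump; lia.
Qed.

(** * Exchanging the two middle rows *)

Lemma lin_sub (op : V -> V) f g : lin op -> op (f - g) = op f - op g.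
Proof.
have E h : - h = scl (-1) h by apply/funext => c; rewrite /scl mulN1r.
by case=> lD lZ; rewrite lD !E lZ.
Qed.

(** With x and y the columns [t] and [t.+1], the difference (y + S)^2 - S (x + y + S) leaves y^2 + y
    S - S x, and y S = q S y. *)
Lemma row_exchange f :
  rowL N.+1 (fun j => t < j)%N (rowL N.+1 (fun j => t < j)%N f)
  - rowL N.+1 (fun j => t.+1 < j)%N (rowL N.+1 (fun j => t <= j)%N f)
  = opL N.+1 t.+1 (opL N.+1 t.+1 f)
    + rowL N.+1 (fun j => t.+1 < j)%N (scl q (opL N.+1 t.+1 f) - opL N.+1 t f).
Proof.
have tN1 : (t < N.+1)%N by lia.
have yN1 : (t.+1 < N.+1)%N by lia.
have Z g : rowL N.+1 (fun j => t < j)%N g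
    = opL N.+1 t.+1 g + rowL N.+1 (fun j => t.+1 < j)%N g.
  rewrite -(rowL1 q _ yN1); apply: rowL_split => j _ /=.
    by rewrite [(t < j)%N]leq_eqVlt eq_sym.
  by case: eqP => // ->; rewrite ltnn.
have ZX g : rowL N.+1 (fun j => t <= j)%N g
    = opL N.+1 t g + rowL N.+1 (fun j => t < j)%N g.
  rewrite -(rowL1 q _ tN1); apply: rowL_split => j _ /=.
    by rewrite leq_eqVlt eq_sym.
  by case: eqP => // ->; rewrite ltnn.
have lS := lin_rowL q N.+1 (fun j => t.+1 < j)%N.
rewrite (lin_sub _ _ lS) ZX !Z (lin_opL q N.+1 t.+1).1 !lS.1 lS.2.
have -> : opL N.+1 t.+1 (rowL N.+1 (fun j => t.+1 < j)%N f)
    = scl q (rowL N.+1 (fun j => t.+1 < j)%N (opL N.+1 t.+1 f)).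
  by rewrite -!(rowL1 q _ yN1); apply: rowLL => i j /eqP->.
by apply/funext => c; rewrite !fctE; ring.
Qed.

(** Letting the rows from [x] on act from the right leaves the block [r2] innermost, where it can be
    replaced by its merged form. *)
Lemma W_assoc M (r0 r1 r2 r3 : seq (pred nat)) x :
  W q M (r0 ++ r1 ++ r2 ++ x :: r3) =
  foldl (fun f r => rowR M r f)
    (foldr (rowL M) (foldr (rowL M) (rowR M x (W q M r2)) r1) r0) r3.
Proof.
have -> : r0 ++ r1 ++ r2 ++ x :: r3 = (r0 ++ r1 ++ rcons r2 x) ++ r3.
  by rewrite -!catA cat_rcons.
by rewrite W_catR !W_cat W_rcons.
Qed.

Lemma scaled_foldr (u : nat -> pred nat) (l : seq nat) f g :
    {in l, forall i j, u i j -> (t.+1 < j)%N} -> scaled 0 f g ->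
  scaled (size l) (foldr (rowL N.+1) f (map u l))
    (foldr (rowL N) g (map (mrow \o u) l)).
Proof.
elim: l => [|i l IH] //= ul fg; apply: scaled_rowL.
  by apply: ul; apply: mem_head.
by apply: IH => // k kl; apply: ul; rewrite in_cons kl orbT.
Qed.

Lemma scaled_foldl k (u : nat -> pred nat) (l : seq nat) f g :
    {in l, forall i j, u i j -> (j < t)%N} -> scaled k f g ->
  scaled k (foldl (fun f r => rowR N.+1 r f) f (map u l))
    (foldl (fun f r => rowR N r f) g (map (mrow \o u) l)).
Proof.
elim: l f g => [|i l IH] //= f g ul fg; apply: IH.
  by move=> k' kl; apply: ul; rewrite in_cons kl orbT.
have ui := ul i (mem_head _ _).
have -> : rowR N (mrow (u i)) g = rowR N (u i) g.
  apply: eq_bigl => j; rewrite /mrow; have [jt|tj] := leqP j t; first by rewrite bump_le.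
  rewrite bump_gt //; apply/idP/idP => /ui; lia.
exact: scaled_rowR.
Qed.

Lemma foldr_sub M rows (f g : V) :
  foldr (rowL M) (f - g) rows = foldr (rowL M) f rows - foldr (rowL M) g rows.
Proof. by elim: rows => //= r rows ->; rewrite (lin_sub _ _ (lin_rowL _ _ _)). Qed.

Lemma foldl_sub M rows (f g : V) :
  foldl (fun f r => rowR M r f) (f - g) rows =
  foldl (fun f r => rowR M r f) f rows - foldl (fun f r => rowR M r f) g rows.
Proof.
by elim: rows f g => //= r rows IH f g; rewrite (lin_sub _ _ (lin_rowR _ _ _)) IH.
Qed.

(** The rows of [a] and [b] contain both x and y, so their product comes from the merged columns.
    Each row of [l] uses one of the places in S, which accounts for the power of [q] on the left;
    the rows of [h] lie left of x and use none. *)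
Lemma W_exchange (u : nat -> pred nat) (l a b h : seq nat) (c : nat -> nat) :
    {in l, forall i j, u i j -> (t.+1 < j)%N} ->
    {in a, forall i j, (t <= j)%N -> u i j} ->
    {in b, forall i j, (j <= t.+1)%N -> u i j} ->
    {in h, forall i j, u i j -> (j < t)%N} ->
    c t = 2%N -> c t.+1 = 2%N ->
  let X r r' := W q N.+1 (map u l ++ [:: r; r'] ++ (map u a ++ map u b) ++
                          (fun j => j <= t)%N :: map u h) c in
  let v := mrow \o u in
  (X (fun j => t < j)%N (fun j => t < j)%N
   - X (fun j => t.+1 < j)%N (fun j => t <= j)%N)
    * q ^+ size l
  = q ^+ gts N.+1 t.+1 c *
    W q N (map v l ++ (map v a ++ (predT : pred nat) :: map v b) ++ map v h) (drp c).
Proof.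
move=> ul ua ub uh ct cy X v; rewrite /X !W_assoc.
set f := rowR N.+1 _ _.
have -> (F G : V) : F c - G c = (F - G) c by [].
rewrite -foldl_sub -foldr_sub /= row_exchange.
rewrite catA W_catR W_cat.
apply: (scaled_foldl (k := size l) uh) => //; apply: scaled_foldr => //.
(* Read backwards, [Phi_W] turns the full row of the right-hand side into [Phi] of the merged
   block. *)
rewrite -(Phi_W q tN); first last.
- by move=> i ib j jt; apply: ub => //; rewrite /bump; lia.
- by move=> i ia j tj; apply: ua => //; rewrite /bump; lia.
have -> : f = opR t (iota_mrg (W q N (map v a ++ map v b)))
    + rowR N.+1 (fun j => j < t)%N (iota_mrg (W q N (map v a ++ map v b)));
  last exact: scaled_Phi.
rewrite -!map_cat -W_iota; last first.
  move=> i; rewrite mem_cat => /orP[ia|ib].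
    by rewrite !ua.
  by rewrite !ub.
rewrite /f -map_cat -(rowR1 q _ (N := N.+1)); last by lia.
apply: rowR_split => j _ /=; first by rewrite leq_eqVlt.
by case: eqP => // ->; rewrite ltnn.
Qed.

End Merge.

(** * Dellac configurations as words *)

Fixpoint winv (s : seq nat) : nat :=
  if s is x :: s' then (count (fun y => x < y) s' + winv s')%N else 0.

Definition content_is N (c : nat -> nat) (s : seq nat) : bool :=
  [forall j : 'I_N, c j == count_mem (j : nat) s].

Definition fits (rows : seq (pred nat)) (s : seq nat) : bool :=
  all2 (fun (r : pred nat) x => r x) rows s.

Section Words.

Variables (K : fieldType) (q : K).

Lemma sum_tuple_cons (T : finType) r (F : seq T -> K) :
  \sum_(w : r.+1.-tuple T) F w
  = \sum_(x : T) \sum_(w : r.-tuple T) F (x :: w).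
Proof.
rewrite pair_big /= (reindex (fun p : T * r.-tuple T => [tuple of p.1 :: p.2])) //=.
exists (fun w : r.+1.-tuple T => (thead w, [tuple of behead w])) => [[x w] _ | w _].
  by rewrite /= theadE; congr (_, _); apply: val_inj.
by apply: val_inj; rewrite /= [in RHS](tuple_eta w).
Qed.

Lemma count_sum N (P : pred nat) (w : seq 'I_N) :
  count P (map val w) = (\sum_(i < N | P i) count_mem (i : nat) (map val w))%N.
Proof.
elim: w => [|x w IH] /=; first by rewrite big1.
rewrite big_split /= IH; congr (_ + _)%N.
rewrite (eq_bigr (fun i : 'I_N => (i == x :> nat) : nat)); last first.
  by move=> i _; rewrite eq_sym.
by rewrite sum_pred1 ltn_ord.
Qed.

(** The letter of the top row forms an inversion with each larger letter below it; the prescribed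
    content makes their number equal to [gts]. *)
Lemma W_words N r (rows : seq (pred nat)) c : size rows = r ->
  W q N rows c = \sum_(w : r.-tuple 'I_N |
     fits rows (map val w) && content_is N c (map val w)) q ^+ winv (map val w).
Proof.
move=> <- {r}.
elim: rows c => [|r rows IH] c.
  rewrite big_mkcond (big_pred1 [tuple]) => [|w]; last by rewrite [w]tuple0; apply/esym/eqP.
  rewrite /= /delta0; have -> : (lts N c == 0%N) = content_is N c [::].
    by rewrite /lts sum_nat_eq0; apply: eq_forallb => i.
  by case: content_is.
rewrite big_mkcond (sum_tuple_cons _ (fun s => if fits (r :: rows) (map val s)
  && content_is N c (map val s) then q ^+ winv (map val s) else 0)).
rewrite /= /rowL fct_sumE big_mkcond; apply: eq_bigr => j _; case: ifP => rj; last first.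
  by rewrite big1.
rewrite /opL /=; case: ifP => cj; last first.
  rewrite big1 // => w _; rewrite ifF //; apply/negbTE/negP => /andP[_ /forallP/(_ j)].
  by rewrite /= eqxx; lia.
rewrite IH big_mkcond mulr_sumr; apply: eq_bigr => w _ /=.
have -> : content_is N c (val j :: map val w) = content_is N (dec j c) (map val w).
  apply: eq_forallb => i; rewrite /= /dec eq_sym [(j : nat) == i]eq_sym.
  case: (eqVneq (i : nat) j) => [-> | _]; last by rewrite add0n subn0 eq_sym.
  by rewrite add1n subn1 eq_sym; case: (c j) cj.
case: ifP => [/andP[_ /forallP cw] | _]; last by rewrite mulr0.
rewrite exprD; congr (q ^+ _ * _); rewrite count_sum; apply: eq_bigr => i ji.
by rewrite -(eqP (cw i)) dec_neq // gtn_eqF.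
Qed.

End Words.

Lemma fits_map (u : nat -> pred nat) a (s : seq nat) :
  fits (map u (iota a (size s))) s
  = [forall i : 'I_(size s), u (a + i)%N (nth 0%N s i)].
Proof.
elim: s a => [|x s IH] a; first by apply/esym/forallP => -[].
rewrite /fits /= -/(fits _ _) IH; apply/andP/forallP => [[ux /forallP us] [[|i] ilt] | us] /=.
- by rewrite addn0.
- by have := us (Ordinal (ilt : (i < size s)%N)); rewrite /= addnS addSn.
- split; first by have := us ord0; rewrite /= addn0.
  by apply/forallP => i; have := us (lift ord0 i); rewrite /= /bump /= add1n addnS addSn.
Qed.

Lemma winv_sum (s : seq nat) :
  winv s = (\sum_(i < size s) \sum_(j < size s)
              ((i < j) && (nth 0 s i < nth 0 s j)))%N.
Proof.
elim: s => [|x s IH] /=; first by rewrite big_ord0.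
rewrite big_ord_recl /=; congr (_ + _)%N.
  rewrite big_ord_recl /= add0n -sum1_count (big_nth 0%N) big_mkord big_mkcond /=.
  by apply: eq_bigr => i _; case: ifP.
by rewrite IH; apply: eq_bigr => i _; rewrite big_ord_recl /= add0n.
Qed.
(** Rows and columns count from 0 here, so a left boundary a allows the columns j >= a. The right
    boundary becomes i + j < 2k for all rows at once, since this always holds when i <= k and j <
    k. *)
Definition rowp (k : nat) (kappa : seq nat) (i : nat) : pred nat :=
  fun j => (nth 0 kappa i <= j)%N && (i + j < 2 * k)%N.

Definition graph (k : nat) (w : (2 * k).-tuple 'I_k) : {set box k} :=
  [set b | tnth w b.1 == b.2].

(** * Configurations as graphs of words *)

Section Graph.

Variables (k : nat) (w : (2 * k).-tuple 'I_k).

Lemma nth_val (i : 'I_(2 * k)) : nth 0%N (map val w) i = tnth w i.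
Proof.
by rewrite (nth_map (tnth w i)) ?size_tuple // -tnth_nth.
Qed.

Lemma graph_row (i : 'I_(2 * k)) : [set b in graph w | b.1 == i] = [set (i, tnth w i)].
Proof.
apply/setP => -[i' j]; rewrite !inE /= xpair_eqE andbC.
by case: eqP => //= ->; rewrite eq_sym.
Qed.

Lemma graph_col (j : 'I_k) :
  #|[set b in graph w | b.2 == j]| = count_mem (j : nat) (map val w).
Proof.
have -> : [set b in graph w | b.2 == j]
    = [set (i, tnth w i) | i in [set i | tnth w i == j]].
  apply/setP => -[i j']; rewrite !inE /=; apply/andP/imsetP => [[/eqP<- wj] | [i']].
    by exists i => //; rewrite inE.
  by rewrite inE => wj [-> ->].
rewrite card_imset; last by move=> i i' [].
rewrite -sum1_count big_map big_tuple -sum1_card.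
by apply: eq_bigl => i; rewrite inE.
Qed.

Lemma inv_graph : inv (graph w) = winv (map val w).
Proof.
rewrite winv_sum /inv size_map size_tuple.
pose g (p : 'I_(2 * k) * 'I_(2 * k)) : box k * box k :=
  ((p.1, tnth w p.1), (p.2, tnth w p.2)).
pose B := [set p : 'I_(2 * k) * 'I_(2 * k) |
  (p.1 < p.2)%N && (tnth w p.1 < tnth w p.2)%N].
transitivity #|g @: B|; last first.
  rewrite card_imset; last by move=> [i i'] [j j'] [-> _ -> _].
  rewrite pair_big -sum1_card big_mkcond /=; apply: eq_bigr => -[i i'] _ /=.
  by rewrite inE /= !nth_val; case: ifP.
congr #|pred_of_set _|; apply/setP => -[[i j] [i' j']]; rewrite !inE /=.
apply/and4P/imsetP => [[/eqP<- /eqP<- ii' ww'] | [[a a']]].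
  by exists (i, i') => //; rewrite inE /=; apply/andP.
by rewrite inE /= => /andP[aa' ww'] [-> -> -> ->].
Qed.

Lemma dellac_graph kappa : dellac kappa (graph w) =
  fits (map (rowp k kappa) (iota 0 (2 * k))) (map val w)
  && content_is k (fun=> 2%N) (map val w).
Proof.
have -> : fits (map (rowp k kappa) (iota 0 (2 * k))) (map val w)
    = [forall i : 'I_(2 * k), rowp k kappa i (tnth w i)].
  have := fits_map (rowp k kappa) 0 (map val w); rewrite size_map size_tuple => ->.
  by apply: eq_forallb => i; rewrite add0n nth_val.
rewrite /dellac; have -> /= : [forall i, #|[set b in graph w | b.1 == i]| == 1%N].
  by apply/forallP => i; rewrite graph_row cards1.
have -> : [forall j, #|[set b in graph w | b.2 == j]| == 2%N]
    = content_is k (fun=> 2%N) (map val w).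
  by apply: eq_forallb => j; rewrite graph_col eq_sym.
rewrite andbC; congr (_ && _); apply/andP/forallP => [[/forallP h1 /forallP h2] i | h].
  have := h1 (i, tnth w i); have := h2 (i, tnth w i).
  rewrite !inE eqxx /= /row_of /col_of /part /rowp /= => h3 h4.
  by have := ltn_ord i; have := ltn_ord (tnth w i); lia.
split; apply/forallP => -[i j]; apply/implyP; rewrite inE /= => /eqP<-;
  have := h i; rewrite /row_of /col_of /part /rowp /=;
  have := ltn_ord i; have := ltn_ord (tnth w i); lia.
Qed.

End Graph.

Lemma dellac_frac_W k kappa : (0 < k)%N ->
  dellac_frac k kappa
  = W qfrac k (map (rowp k kappa) (iota 0 (2 * k))) (fun=> 2%N).
Proof.
case: k => // k _; rewrite (@W_words _ _ _ (2 * k.+1)%N) ?size_map ?size_iota //.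
rewrite /dellac_frac /dellac_poly rmorph_sum /=.
(* [h] reads off the column of the dot in each row; a configuration has a dot in every row, so the
   default [ord0] never arises for it. *)
pose h (C : {set box k.+1}) : (2 * k.+1).-tuple 'I_k.+1 :=
  [tuple odflt ord0 [pick j | (i, j) \in C] | i < 2 * k.+1].
have hK w : h (graph w) = w.
  apply: eq_from_tnth => i; rewrite tnth_mktuple; case: pickP => [j|].
    by rewrite inE /= => /eqP.
  by move/(_ (tnth w i)); rewrite inE eqxx.
rewrite (reindex_onto (@graph k.+1) h) => [|C /and4P[/forallP rC _ _ _]].
  apply: eq_big => [w | w _]; first by rewrite hK eqxx andbT dellac_graph.
  by rewrite inv_graph rmorphXn.
apply/setP => -[i j]; rewrite inE /= tnth_mktuple.
have /cards1P[[i' b] Cb] := rC i.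
have inC j' : ((i, j') \in C) = (j' == b).
  have : (i', b) \in [set b0 in C | b0.1 == i] by rewrite Cb inE.
  rewrite inE /= => /andP[_ /eqP ii']; rewrite ii' in Cb.
  have : ((i, j') \in [set b0 in C | b0.1 == i]) = ((i, j') \in [set (i, b)]).
    by rewrite Cb.
  by rewrite !inE /= eqxx andbT xpair_eqE eqxx.
rewrite inC; case: pickP => [j' | /(_ b)]; rewrite inC => /eqP // ->.
by rewrite eq_sym.
Qed.

(** * The recurrence *)

Section RowLists.

Variables (K : fieldType) (q : K) (N : nat).

Lemma W_cons_ext (r r' : pred nat) rows rows' :
    (forall j, (j < N)%N -> r j = r' j) -> W q N rows = W q N rows' ->
  W q N (r :: rows) = W q N (r' :: rows').
Proof. by move=> rr' /= ->; apply: eq_rowL. Qed.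

Lemma W_map_ext (u v : nat -> pred nat) (s : seq nat) rows rows' :
    {in s, forall i j, (j < N)%N -> u i j = v i j} -> W q N rows = W q N rows' ->
  W q N (map u s ++ rows) = W q N (map v s ++ rows').
Proof.
elim: s => //= i s IH uv E; apply: (@W_cons_ext (u i) (v i)).
  by apply: uv; apply: mem_head.
by apply: IH => // k ks; apply: uv; rewrite in_cons ks orbT.
Qed.

Lemma W_empty_row (r : pred nat) rows : (forall j, (j < N)%N -> ~~ r j) ->
  W q N (r :: rows) = 0.
Proof. by move=> r0; apply: big1 => j rj; have := r0 j (ltn_ord j); rewrite rj. Qed.

Lemma gts_const (t a : nat) : gts N t (fun=> a) = (a * (N - t.+1))%N.
Proof.
rewrite /gts; elim: N => [|M IH]; first by rewrite big_ord0 muln0.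
rewrite big_mkcond big_ord_recr -big_mkcond /= IH subSS.
case: ltnP => tM; first by rewrite -[in RHS](subnSK tM) mulnS addnC.
by rewrite addn0; congr (_ * _)%N; lia.
Qed.

End RowLists.

(** The positive parts of a partition form an initial segment. *)
Lemma nth_count_gt0 (s : seq nat) i : is_partition s ->
  (count (fun p => 0 < p)%N s <= i)%N -> nth 0%N s i = 0%N.
Proof.
elim: s i => [|x s IH] i; first by rewrite nth_nil.
rewrite /is_partition /= => sx; have ss := path_sorted sx.
have : all (geq x) s by apply: order_path_min sx => y z w /=; lia.
case: x sx => [|x] _ /= xs; last by case: i => // i le; apply: IH.
case: i => // i _; case: (ltnP i (size s)) => [ilt|]; last exact: nth_default.
by have := all_nthP 0%N xs i ilt; rewrite /= leqn0 => /eqP.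
Qed.

Lemma nth_le_head (s : seq nat) i : is_partition s -> (nth 0 s i <= nth 0 s 0)%N.
Proof.
case: s => [|x s]; first by rewrite !nth_nil.
rewrite /is_partition /= => sx; case: i => // i /=.
have xs : all (geq x) s by apply: order_path_min sx => y z w /=; lia.
case: (ltnP i (size s)) => [ilt|]; last by move=> /(nth_default 0%N)->.
exact: (all_nthP 0%N xs i ilt).
Qed.

Section Recurrence.

(** [N] stands for n - 1, and [t] for m - 1, the index of column m counted from 0. *)
Variables (N t : nat) (lam nu : seq nat).
Hypothesis tN : (t < N)%N.
Hypothesis lamP : forall i, (i < size lam)%N -> (t.+1 < nth 0 lam i)%N.
Hypothesis nuP : forall i, (nth 0 nu i <= t)%N.
Hypothesis nu0 : forall i, (N <= size lam + 2 + i)%N -> nth 0%N nu i = 0%N.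
Hypothesis szN : (size lam + 2 <= N)%N.

Local Notation l := (size lam).
Local Notation n := N.+1.
Let kappa0 := lam ++ [:: t.+1; t.+1] ++ nu.
Let kappa1 := lam ++ [:: t.+2; t] ++ nu.
Let kappa2 := [seq (x - 1)%N | x <- lam] ++ nu.

(* For rows i <= n the right boundary is void on columns j < n; without it these
   rows contain every column from some point on. *)
Let u (i : nat) : pred nat :=
  fun j => (nth 0 kappa0 i <= j)%N && ((i <= n)%N || (i + j < 2 * n)%N).

(** The rows other than [l], [l.+1] and 2n - t - 1, from top to bottom: those of lambda; those down
    to index n; those below whose right boundary still allows y; and those confined to the columns
    left of x. *)
Let la := iota 0 l.
Let aa := iota l.+2 (N - l).
Let ba := iota n.+1 (N - t.+1).
Let ha := iota (2 * n - t) t.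

Lemma iota_split :
  iota 0 (2 * n) = la ++ [:: l; l.+1] ++ (aa ++ ba) ++ (2 * n - t.+1)%N :: ha.
Proof.
have {1}-> : (2 * n = l + (2 + ((N - l) + (N - t.+1) + t.+1)))%N.
  by move: tN szN; lia.
rewrite iotaD add0n; congr (_ ++ _); rewrite iotaD /=; congr [:: _, _ & _].
rewrite !iotaD addn2 -!catA; congr (_ ++ _); congr (iota _ _ ++ _ :: iota _ _);
  by move: tN szN; lia.
Qed.

(** Row [N] is singled out because both boundaries are void there: it is the inserted full row. *)
Lemma iota_split' :
  iota 0 (2 * N) = la ++ (iota l (N - l) ++ N :: iota n (N - t.+1)) ++ iota (2 * N - t) t.
Proof.
have {1}-> : (2 * N = l + ((N - l) + (1 + (N - t.+1)) + t))%N.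
  by move: tN szN; lia.
rewrite !iotaD add0n /=; congr (_ ++ (_ ++ _) ++ iota _ _);
  move: tN szN; try lia.
by move=> *; congr (_ :: iota _ _); lia.
Qed.

Lemma nth_low lam' i : (i < l)%N -> nth 0%N (lam ++ lam') i = nth 0%N lam i.
Proof. by move=> il; rewrite nth_cat il. Qed.

Lemma nth_high a b i : nth 0%N (lam ++ [:: a; b] ++ nu) (l.+2 + i) = nth 0%N nu i.
Proof.
rewrite nth_cat ifF; last by lia.
by rewrite (_ : l.+2 + i - l = i.+2)%N //; lia.
Qed.

Lemma nth_mid a b i : nth 0%N (lam ++ [:: a; b] ++ nu) (l + i) = nth 0%N ([:: a; b] ++ nu) i.
Proof. by rewrite nth_cat ifF ?addKn //; lia. Qed.

Variables (K : fieldType) (q : K).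

(** Only rows [l] and [l.+1] depend on [a] and [b], so this serves both [kappa0] and [kappa1]. The
    row ending at column [t] is row 2n - t - 1. *)
Lemma W_kappa a b :
  W q n (map (rowp n (lam ++ [:: a; b] ++ nu)) (iota 0 (2 * n)))
  = W q n (map u la ++ [:: (fun j => a <= j)%N; (fun j => b <= j)%N]
      ++ (map u aa ++ map u ba) ++ (fun j => j <= t)%N :: map u ha).
Proof.
rewrite iota_split !map_cat; apply: W_map_ext => [i|].
  rewrite mem_iota add0n /= => il j jn.
  rewrite /rowp /u /kappa0 !nth_low //; move: szN; lia.
apply: W_cons_ext => [j jn|].
  rewrite /rowp -(addn0 l) nth_mid /=; move: szN; lia.
apply: W_cons_ext => [j jn|].
  rewrite /rowp -(addn1 l) nth_mid /=; move: szN; lia.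
have hi i j : (l.+2 <= i)%N -> (j < n)%N ->
    rowp n (lam ++ [:: a; b] ++ nu) i j = u i j.
  move=> li jn; rewrite /rowp /u /kappa0 -(subnKC li) !nth_high subnKC //.
  by lia.
rewrite -!catA; apply: W_map_ext => [i|].
  by rewrite mem_iota => /andP[li _] j jn; apply: hi.
apply: W_map_ext => [i|].
  rewrite mem_iota => /andP[li _] j jn; apply: hi => //.
  by move: szN; lia.
apply: W_cons_ext => [j jn|].
  rewrite hi //; last by move: tN szN; lia.
  rewrite /u /kappa0 -(subnKC (_ : l.+2 <= 2 * n - t.+1)%N); last first.
    by move: tN szN; lia.
  rewrite nth_high nu0; last by move: tN szN; lia.
  by move: tN szN; lia.
have := @W_map_ext K q n (rowp n (lam ++ [:: a; b] ++ nu)) u ha [::] [::].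
rewrite !cats0; apply=> // i.
rewrite mem_iota => /andP[li _] j jn; apply: hi => //.
by move: tN szN; lia.
Qed.

(** Deleting column y lowers the parts of lambda by one, as they exceed [t.+1], and keeps those of
    nu, as they are at most [t]. *)
Lemma W_kappa2 :
  let v := mrow t \o u in
  W q N (map (rowp N kappa2) (iota 0 (2 * N)))
  = W q N (map v la ++ (map v aa ++ (predT : pred nat) :: map v ba) ++ map v ha).
Proof.
move=> v.
have low i j : (i < l)%N -> (j < N)%N -> rowp N kappa2 i j = v i j.
  move=> il jN; rewrite /v /= /mrow /u /rowp /kappa0 /kappa2 nth_low //.
  rewrite nth_cat size_map il (nth_map 0%N) //; have := lamP il.
  by move: szN; rewrite /bump; lia.
have high i : nth 0%N kappa2 (l + i) = nth 0%N nu i.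
  by rewrite nth_cat size_map ltnNge leq_addr /= addKn.
have zero i : (N <= i)%N -> nth 0%N kappa2 i = 0%N.
  move=> Ni; have li : (l <= i)%N by move: szN; lia.
  by rewrite -(subnKC li) high nu0 //; lia.
have zero0 i : (N < i)%N -> nth 0%N kappa0 i = 0%N.
  move=> Ni; have li : (l.+2 <= i)%N by move: szN; lia.
  by rewrite -(subnKC li) nth_high nu0 //; lia.
have vE i j : v i j = u i (bump t.+1 j) by [].
rewrite iota_split' !map_cat -!catA; apply: W_map_ext => [i|].
  by rewrite mem_iota add0n => /andP[_ il] j jN; apply: low.
(* The row shifts are 2 after the removal of rows [l] and [l.+1], 1 below the inserted row, and 2
   again below the removed row 2n - t - 1. *)
have -> : map v aa = map (fun i => v (2 + i)%N) (iota l (N - l)).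
  by rewrite /aa -add2n iotaDl -map_comp.
have -> : map v ba = map (fun i => v (1 + i)%N) (iota n (N - t.+1)).
  by rewrite /ba -add1n iotaDl -map_comp.
have -> : map v ha = map (fun i => v (2 + i)%N) (iota (2 * N - t) t).
  rewrite /ha (_ : 2 * n - t = 2 + (2 * N - t))%N ?iotaDl -?map_comp //.
  by move: tN; lia.
apply: W_map_ext => [i|].
  rewrite mem_iota => /andP[li iN] j jN.
  rewrite vE /rowp /u -{1}(subnKC li) high /kappa0.
  rewrite -[in RHS](subnKC li) addnA add2n nth_high.
  have := nuP (i - l); rewrite /bump; move: szN li iN => *; lia.
apply: W_cons_ext => [j jN|].
  by rewrite /rowp zero //=; lia.
apply: W_map_ext => [i|].
  rewrite mem_iota => /andP[li iN] j jN; rewrite vE /rowp /u zero; last by lia.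
  rewrite zero0; last by lia.
  have {}iN : (i < N.+1 + (N - t.+1))%N := iN.
  by move: tN iN li; rewrite /bump => *; lia.
have := @W_map_ext K q N (rowp N kappa2) (fun i => v (2 + i)%N)
  (iota (2 * N - t) t) [::] [::].
rewrite !cats0; apply=> // i; rewrite mem_iota => /andP[li iN] j jN.
rewrite vE /rowp /u zero; last by move: tN; lia.
rewrite zero0; last by move: tN; lia.
by move: tN iN li; rewrite /bump => *; lia.
Qed.

Hypothesis q0 : q != 0.

Lemma W_recurrence :
  (W q n (map (rowp n kappa0) (iota 0 (2 * n))) (fun=> 2%N)
   - W q n (map (rowp n kappa1) (iota 0 (2 * n))) (fun=> 2%N)) * q ^+ l
  = q ^+ (2 * (N - t.+1)) * W q N (map (rowp N kappa2) (iota 0 (2 * N))) (fun=> 2%N).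
Proof.
rewrite !W_kappa W_kappa2.
have := @W_exchange K q N t tN q0 u la aa ba ha (fun=> 2%N).
(* Two dots in each column right of y give the exponent 2(N - t - 1). *)
rewrite /= size_iota gts_const subSS.
apply=> //.
- move=> i; rewrite mem_iota add0n => /andP[_ il] j /andP[+ _].
  by rewrite nth_low //; apply: leq_trans; apply: lamP.
- move=> i; rewrite mem_iota => /andP[li il] j tj.
  rewrite /u /kappa0 -{1}(subnKC li) nth_high (leq_trans (nuP _) tj) /=.
  by move: szN il; lia.
- move=> i; rewrite mem_iota => /andP[li il] j tj.
  have li' : (l.+2 <= i)%N by move: szN; lia.
  rewrite /u /kappa0 -{1}(subnKC li') nth_high nu0; last by move: szN; lia.
  by move: tN; lia.
- move=> i; rewrite mem_iota => /andP[li il] j /andP[_].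
  by move: tN; lia.
Qed.

End Recurrence.

Section Zero.

Variables (k : nat) (kappa : seq nat).
Hypothesis k0 : (0 < k)%N.

(** The left boundary then fills the whole first row, leaving no box for its dot. *)
Lemma dellac_frac_eq0 : (k <= nth 0 kappa 0)%N -> dellac_frac k kappa = 0.
Proof.
move=> kk; rewrite dellac_frac_W //; case: k k0 kk => // k' _ kk.
rewrite mulnS [map _ _]/= W_empty_row // => j jk.
by rewrite /rowp; lia.
Qed.

End Zero.

Lemma qfrac_neq0 : qfrac != 0.
Proof. by rewrite tofrac_eq0 polyX_eq0. Qed.

Local Close Scope ring_scope.

Theorem theorem7p18 (n m : nat) (lam nu : seq nat)
  (hn : 2 <= n) (hm : 1 <= m)
  (hlam : is_partition lam)
  (hlam_ge : forall i : nat, 1 <= i <= size lam -> m + 1 <= part lam i)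
  (hnu : is_partition nu)
  (hnu_le : part nu 1 <= m - 1)
  (kappa0 := lam ++ [:: m; m] ++ nu)
  (kappa1 := lam ++ [:: m + 1; m - 1] ++ nu)
  (kappa2 := [seq x - 1 | x <- lam] ++ nu)
  (hparts : count (fun p => 0 < p) kappa0 <= n - 1)
  (hmult : forall p : nat, 0 < p -> count_mem p kappa0 <= 2)
  (* Only the case of empty lam with m >= n is excluded; there the identity
     can fail. *)
  (hmn : lam = [::] -> m <= n - 1)
  (beta := (2 * (n%:Z - m%:Z - 1) - (size lam)%:Z)%R) :
  (dellac_frac n kappa0
   = dellac_frac n kappa1 + qfrac ^ beta * dellac_frac (n - 1) kappa2)%R.
Proof.
(* If n <= m, then lambda is nonempty with first part at least m + 1, so the boundaries of all three
   terms fill their first rows and everything vanishes. *)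
case: (leqP n m) => [nm | mn].
  rewrite /kappa0 /kappa1 /kappa2 /beta; move: hlam_ge hmn; clear -hn nm.
  case: lam => [_ /(_ erefl)|x lam' /(_ 1) + _]; first by lia.
  rewrite /part /= => /(_ isT) mx.
  by rewrite !dellac_frac_eq0 ?mulr0 ?addr0 //=; lia.
case: n hn hparts hmn @beta mn => // N N1 hparts hmn beta mN.
case: m hm hlam_ge hnu_le @kappa0 hmult hparts @kappa1 @beta hmn mN
  => // t _ hlam_ge hnu_le kappa0 hmult hparts kappa1 beta hmn tN.
rewrite subn1 /= in hparts *.
have lamP i : i < size lam -> t.+1 < nth 0 lam i.
  by move=> il; have := hlam_ge i.+1 il; rewrite /part /=; lia.
have nuP i : nth 0 nu i <= t.
  by have := nth_le_head i hnu; move: hnu_le; rewrite /part /=; lia.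
have cnt : count (fun p => 0 < p) lam = size lam.
  by apply/eqP; rewrite -all_count; apply/(all_nthP 0) => i /lamP; lia.
(* The parts of lambda and the two parts m are positive, so the bound on positive parts leaves at
   most N - l - 2 of them for nu. *)
have szN : size lam + 2 + count (fun p => 0 < p) nu <= N.
  by move: hparts; rewrite /kappa0 !count_cat cnt /=; lia.
have nu0 i : N <= size lam + 2 + i -> nth 0 nu i = 0.
  by move=> Ni; apply: nth_count_gt0 => //; lia.
have := W_recurrence (ltnSE tN) lamP nuP nu0 (leq_trans (leq_addr _ _) szN) qfrac_neq0.
have N0 : 0 < N by lia.
rewrite -!dellac_frac_W //.
rewrite -/kappa0 -/kappa2 (_ : lam ++ [:: t.+2; t] ++ nu = kappa1); last first.
  by rewrite /kappa1 addn1 subn1.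
have ql : (qfrac ^+ size lam != 0)%R by rewrite expf_neq0 // qfrac_neq0.
(* The exponent beta may be negative, so the identity is compared after multiplication by q^l. *)
move=> E; apply/eqP; rewrite addrC -subr_eq; apply/eqP.
apply: (mulIf ql); rewrite E mulrAC; congr (_ * _)%R.
rewrite -[(qfrac ^+ size lam)%R]/(qfrac ^ (size lam)%:Z)%R -expfzDr ?qfrac_neq0 //.
by rewrite /beta subrK -[LHS]/(qfrac ^ (2 * (N - t.+1))%:Z)%R; congr (_ ^ _)%R; lia.
Qed.
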